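(* For each integer $n\ge 0$, let $a_n$ denote the number of tilings of a $5\times 8n$ board by $L$-tetrominoes (rotations allowed, reflections not allowed). Then the generating function is \[ \sum_{n\geq 0}a_nt^n= \frac{2 t^{4}+2 t^{3}+t^{2}-1}{4 t^{4}+4 t^{3}+4 t^{2}+2 t -1}.\] Consequently, \[a_n=2a_{n-1}+4a_{n-2}+4a_{n-3}+4a_{n-4}\quad\text{for all } n\geq 5,\] with initial values $a_0=1$, $a_1=2$, $a_2=7$, $a_3=24$, $a_4=86$. The first terms of the sequence $(a_n)_{n\ge 0}$ are $1,2,7,24,86,304,1076,3808,\ldots$
   Context: A $k\times n$ board is the rectangle of unit cells $\{(x,y)\in\mathbb{Z}^2: 0\le x<n,\ 0\le y<k\}$, where each cell is named by its bottom left corner. The $L$-tetromino tiles are the translates of the four sets (the rotations of the $L$-tetromino) \[\{(0,0),(0,1),(0,2),(1,0)\},\ \{(0,0),(0,1),(1,1),(2,1)\},\ \{(0,0),(1,0),(2,0),(2,1)\},\ \{(0,2),(1,0),(1,1),(1,2)\}.\] Reflections of these shapes are not allowed. A tiling of a board is a partition of its set of cells into such tiles (each tile may be used any number of times); two tilings are the same only if they are equal as partitions of the board (no identification under symmetries). The empty board ($n=0$) has exactly one tiling. Generating functions are formal power series in $t$ with rational coefficients. *)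

(* Defs.v *)
From HB Require Import structures.
From mathcomp Require Import all_boot all_order all_algebra.
Set Implicit Arguments.
Unset Strict Implicit.
Unset Printing Implicit Defensive.
Import Order.TTheory GRing.Theory Num.Theory.
Local Open Scope ring_scope.

(* The cell with bottom left corner (x, y) of the k x n board (k rows,
   n columns) is the pair (x, y). *)
Definition cell (k n : nat) : finType := ('I_n * 'I_k)%type.

Definition corner (k n : nat) (c : cell k n) : int * int :=
  ((c.1 : nat)%:Z, (c.2 : nat)%:Z).

Definition L_shapes : seq (seq (int * int)) :=
  [:: [:: (0, 0); (0, 1); (0, 2); (1, 0)];
      [:: (0, 0); (0, 1); (1, 1); (2, 1)];
      [:: (0, 0); (1, 0); (2, 0); (2, 1)];
      [:: (0, 2); (1, 0); (1, 1); (1, 2)] ].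

Definition translate (v : int * int) (s : seq (int * int)) :
  seq (int * int) := [seq v + p | p <- s].

Definition is_L_tile (k n : nat) (T : {set cell k n}) : Prop :=
  exists v : int * int, exists2 s, s \in L_shapes &
    [seq corner c | c <- enum T] =i translate v s.

(* Decision procedure for is_L_tile. The bounding box of each shape has its
   lower left corner at the origin, so only translations by a vector lying in
   the board have to be tried. *)
Definition is_L_tileb (k n : nat) (T : {set cell k n}) : bool :=
  [exists v : cell k n, has (fun s =>
    perm_eq [seq corner c | c <- enum T] (translate (corner v) s)) L_shapes].

Lemma corner_inj (k n : nat) : injective (@corner k n).
Proof. by move=> [x y] [x' y'] [] /val_inj -> /val_inj ->. Qed.

Lemma is_L_tileP (k n : nat) (T : {set cell k n}) :
  reflect (is_L_tile T) (is_L_tileb T).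
Proof.
apply: (iffP existsP) => [[v /hasP[s sL /perm_mem eqT]] | [v [s sL eqT]]].
  by exists (corner v), s.
have inT p : p \in s -> exists2 c : cell k n, c \in T & corner c = v + p.
  move=> ps; have: v + p \in translate v s by rewrite map_f.
  by rewrite -eqT => /mapP[c]; rewrite mem_enum => cT ->; exists c.
have us : uniq (translate v s).
  rewrite map_inj_uniq; last exact: addrI.
  by move: sL; rewrite !inE => /or4P[] /eqP->.
have [c0 Ec0] : exists c0 : cell k n, corner c0 = v.
  have [[p ps p1] [q qs q2]] :
      (exists2 p, p \in s & p.1 = 0) /\ (exists2 q, q \in s & q.2 = 0).
    move: sL; rewrite !inE => /or4P[] /eqP->; split;
      by [exists (0, 0) | exists (0, 2) | exists (1, 0)].
  have [c _ [Ec _]] := inT p ps; have [d _ [_ Ed]] := inT q qs.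
  exists (c.1, d.2); rewrite /corner /= Ec Ed p1 q2 !addr0.
  by rewrite -surjective_pairing.
exists c0; apply/hasP; exists s => //; rewrite Ec0; apply: uniq_perm => //.
by rewrite (map_inj_uniq (@corner_inj k n)) enum_uniq.
Qed.

Definition tilings (k n : nat) : {set {set {set cell k n}}} :=
  [set P | partition P [set: cell k n] & [forall T in P, is_L_tileb T]].

Definition a (n : nat) : nat := #|tilings 5 (8 * n)|.

(* The formal power series \sum_n f_n t^n is represented by its coefficient
   sequence f; equality of series is extensional equality =1. *)
Definition fps (F : fieldType) := nat -> F.

Section FormalPowerSeries.
Variable F : fieldType.

Definition fps_of_poly (p : {poly F}) : fps F := fun n => p`_n.

Definition fps_mul (f g : fps F) : fps F :=
  fun n => \sum_(i < n.+1) f i * g (n - i)%N.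

(* The first n.+1 coefficients of the inverse of f, obtained by solving
   \sum_(i < m.+1) f_i g_(m - i) = (m == 0) for g_m. *)
Fixpoint fps_inv_seq (f : fps F) (n : nat) : seq F :=
  if n is m.+1 then
    let s := fps_inv_seq f m in
    rcons s (- (f 0)^-1 * \sum_(i < n) f i.+1 * s`_(m - i))
  else [:: (f 0)^-1].

(* Meaningful only when f 0 != 0; see fps_mulV. *)
Definition fps_inv (f : fps F) : fps F := fun n => (fps_inv_seq f n)`_n.

Definition fps_div (f g : fps F) : fps F := fps_mul f (fps_inv g).

Lemma size_fps_inv_seq f n : size (fps_inv_seq f n) = n.+1.
Proof. by elim: n => //= n IHn; rewrite size_rcons IHn. Qed.

Lemma nth_fps_inv_seq f n i : (i <= n)%N -> (fps_inv_seq f n)`_i = fps_inv f i.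
Proof.
elim: n => [|n IHn]; first by rewrite leqn0 => /eqP->.
rewrite leq_eqVlt => /predU1P[-> // | lt_in].
by rewrite /= nth_rcons size_fps_inv_seq lt_in IHn.
Qed.

Lemma fps_mulV (f : fps F) : f 0 != 0 ->
  fps_mul f (fps_inv f) =1 fps_of_poly 1.
Proof.
move=> f0 [|n]; rewrite /fps_mul /fps_of_poly coef1.
  by rewrite big_ord1 mulfV.
rewrite big_ord_recl subn0 /fps_inv /= nth_rcons size_fps_inv_seq ltnn eqxx.
rewrite mulrA mulrN mulfV // mulN1r addrC; apply/eqP; rewrite subr_eq0.
by apply/eqP/eq_bigr => i _; rewrite subSS -!/(fps_inv f _) !nth_fps_inv_seq ?leq_subr.
Qed.

End FormalPowerSeries.

(* Main.v *)
(* Filling the board column by column, always covering the first free cell,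
   turns tilings into paths of a transfer matrix whose states record the cells
   covered ahead of the first free one.  Let r_k be the row vector counting the
   paths from the empty state to each state after 8 k columns.  Only a dozen
   states occur, and r_5 = 2 r_4 + 4 r_3 + 4 r_2 + 4 r_1 holds exactly, by
   computation; this is the recurrence for a_n, and multiplying out gives the
   generating function. *)
Require Import Defs.
From mathcomp Require Import all_boot all_order all_algebra.
From mathcomp Require Import zify ring.
Set Implicit Arguments.
Unset Strict Implicit.
Unset Printing Implicit Defensive.
Import Order.TTheory GRing.Theory Num.Theory.
Local Open Scope ring_scope.

(** * Tilings of a finite set by prescribed blocks *)

Section TilingsOfSet.
Variables (T : finType) (tile : pred {set T}).

Definition set_tilings (S : {set T}) : {set {set {set T}}} :=
  [set P | partition P S & [forall B in P, tile B]].

Lemma set_tilingsP (S : {set T}) (P : {set {set T}}) :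
  reflect (partition P S /\ {in P, forall B, tile B}) (P \in set_tilings S).
Proof. by rewrite inE; apply: (iffP andP) => -[pP /forall_inP]. Qed.

Lemma card_set_tilings0 : #|set_tilings set0| = 1%N.
Proof.
rewrite -(cards1 (set0 : {set {set T}})); apply: eq_card => P.
rewrite !inE partition_set0; case: eqP => // ->.
by apply/forall_inP=> B; rewrite inE.
Qed.

(** Removing [B] and adding it back are inverse bijections: being nonempty, [B] cannot already be a
    block of a tiling of [S :\: B]. *)
Lemma card_set_tilings_block (S B : {set T}) :
  B != set0 -> B \subset S -> tile B ->
  #|[set P in set_tilings S | B \in P]| = #|set_tilings (S :\: B)|.
Proof.
move=> nzB sBS tB.
have notin P : P \in set_tilings (S :\: B) -> B \notin P.
  case/set_tilingsP=> /partitionS sP _; apply: contra nzB => /sP.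
  by rewrite subsetD => /andP[_]; rewrite -setI_eq0 setIid.
rewrite -[RHS](card_in_imset (f := setU [set B])) => [|P Q hP hQ eqPQ]; last first.
  by rewrite -(setU1K (notin P hP)) -(setU1K (notin Q hQ)) eqPQ.
apply: eq_card => P; apply/idP/imsetP.
  rewrite inE => /andP[/set_tilingsP[partP tP] BP].
  exists (P :\ B); last by rewrite setD1K.
  by apply/set_tilingsP; split=> [|C /setD1P[_ /tP //]]; apply: partitionD1.
case=> Q /set_tilingsP[partQ tQ] ->; rewrite inE setU11 andbT.
apply/set_tilingsP; split=> [|C /setU1P[-> //|/tQ //]].
rewrite -{1}(setID S B) (setIidPr sBS).
by apply: partitionU1 => //; rewrite disjoint_sym disjoints_subset setDE subsetIr.
Qed.

(* Classify the tilings by the tile covering x. *)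
Lemma card_set_tilings (S : {set T}) (x : T) : x \in S ->
  #|set_tilings S| =
  (\sum_(B | [&& tile B, x \in B & B \subset S]) #|set_tilings (S :\: B)|)%N.
Proof.
move=> xS; rewrite -sum1_card.
rewrite (partition_big (fun P => pblock P x)
           (fun B => [&& tile B, x \in B & B \subset S])) => [|P] /=; last first.
  case/set_tilingsP=> partP tP; have xP : x \in cover P by rewrite (cover_partition partP).
  by rewrite tP ?pblock_mem // mem_pblock xP (partitionS partP) // pblock_mem.
apply: eq_bigr => B /and3P[tB xB sBS].
rewrite -card_set_tilings_block //; last by apply/set0Pn; exists x.
rewrite -sum1_card; apply: eq_bigl => P; rewrite [in RHS]inE.
apply: andb_id2l => /set_tilingsP[partP _].
have xP : x \in cover P by rewrite (cover_partition partP).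
apply/eqP/idP=> [<-|BP]; first exact: pblock_mem.
exact: def_pblock (partition_trivIset partP) BP xB.
Qed.

End TilingsOfSet.

(** * States of the column-by-column filling *)

(* Cells of a board with 5 rows are ordered by lin (x, y) = 5 * x + y, that is,
   column by column. *)
Definition lin (u : int * int) : int := 5 * u.1 + u.2.

(* The four shapes, translated so that their first cell is (0, 0). *)
Definition first_shapes : seq (seq (int * int)) :=
  [:: [:: (0, 0); (0, 1); (0, 2); (1, 0)];
      [:: (0, 0); (0, 1); (1, 1); (2, 1)];
      [:: (0, 0); (1, 0); (2, 0); (2, 1)];
      [:: (0, 0); (1, -2); (1, -1); (1, 0)]].

(** On [first_shapes] the values of [lin] are nonnegative, so the absolute value only converts them
    to [nat]. *)
Definition offsets (s : seq (int * int)) : seq nat := [seq `|lin u|%N | u <- s].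

Definition tile_offsets (y : nat) : seq (seq nat) :=
  [seq offsets s | s <- first_shapes & all (fun u => 0 <= y%:Z + u.2 < 5) s].

Definition shift (w : seq nat) : seq nat := [seq i.-1 | i <- w & (0 < i)%N].

Lemma mem_shift w i : (i \in shift w) = (i.+1 \in w).
Proof.
apply/mapP/idP=> [[j] | iw]; last by exists i.+1; rewrite ?mem_filter.
by rewrite mem_filter => /andP[]; case: j => // j _ jw ->.
Qed.

(* A state w lists the offsets, from the first undecided cell, of the cells that
   are already covered; the tile [::] is used when that first cell is covered. *)
Definition succs (y : nat) (w : seq nat) : seq (seq nat) :=
  [seq shift (merge leq w t) |
    t <- if 0%N \in w then [:: [::]]
         else [seq t <- tile_offsets y | ~~ has (mem w) t]].

(** Here [q] cells remain and the first of them lies in row [y]. A nonempty state at [q = 0] means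
    that some tile sticks out of the board on the right. *)
Fixpoint completions (q y : nat) (w : seq nat) : nat :=
  if q is q'.+1 then
    (\sum_(w' <- succs y w) completions q' (y.+1 %% 5) w')%N
  else w == [::].

Lemma completionsS q y w :
  completions q.+1 y w = (\sum_(w' <- succs y w) completions q (y.+1 %% 5) w')%N.
Proof. by []. Qed.

(* Tiles leaving the board are not excluded from succs; they admit no
   completion. *)
Lemma completions_overflow q y w i :
  i \in w -> (q <= i)%N -> completions q y w = 0%N.
Proof.
elim: q y w i => [|q IHq] y w i iw; first by case: w iw.
case: i iw => // i iw le_qi; rewrite completionsS.
apply: big1_seq => w' /mapP[t _ ->].
by rewrite (IHq _ _ i) // mem_shift mem_merge mem_cat iw.
Qed.

(** The origin is the strict minimum of each shape for the order by [lin]; this forces a tile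
    covering the first free cell to be anchored there. *)
Lemma first_shapesP s u : s \in first_shapes -> u \in s ->
  [/\ (0, 0) \in s, 0 <= lin u & lin u = 0 -> u = 0].
Proof. by rewrite !inE => /or4P[] /eqP->; rewrite !inE => /or4P[] /eqP->. Qed.

Lemma sorted_tile_offsets y t : t \in tile_offsets y -> sorted ltn t.
Proof.
case/mapP=> s; rewrite mem_filter => /andP[_ sL] ->.
by move: sL; rewrite !inE => /or4P[] /eqP->.
Qed.

Lemma uniq_tile_offsets y : uniq (tile_offsets y).
Proof. exact: (subseq_uniq (map_subseq _ (filter_subseq _ _))). Qed.

(** * Tilings of the final part of a board *)

Section Board.
Variable N : nat.
Implicit Types (c : cell 5 N) (T : {set cell 5 N}).

Definition index (c : cell 5 N) : nat := 5 * c.1 + c.2.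

Definition region (p : nat) (w : seq nat) : {set cell 5 N} :=
  [set c | (p <= index c)%N && (index c - p \notin w)%N].

Definition tile_at (p : nat) (t : seq nat) : {set cell 5 N} :=
  [set c | (p <= index c)%N && (index c - p \in t)%N].

Lemma corner_onto (z : int * int) :
  0 <= z.2 < 5 -> 0 <= lin z < 5 * N%:Z -> exists c, corner c = z.
Proof.
case: z => x y; rewrite /lin /= => hy hz.
have lx : (`|x| < N)%N by lia.
have ly : (`|y| < 5)%N by lia.
by exists (Ordinal lx, Ordinal ly); congr (_, _) => /=; lia.
Qed.

Lemma corner_bounds c :
  [/\ lin (corner c) = index c, 0 <= (corner c).2 < 5 &
      (index c < 5 * N)%N].
Proof.
case: c => x y; have := (ltn_ord x, ltn_ord y).
by rewrite /lin /index /corner /= => -[? ?]; split; lia.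
Qed.

Lemma lin_inj (z z' : int * int) :
  0 <= z.2 < 5 -> 0 <= z'.2 < 5 -> lin z = lin z' -> z = z'.
Proof.
by case: z z' => [x y] [x' y']; rewrite /lin /= => *; congr (_, _); lia.
Qed.

Lemma linD u v : lin (u + v) = lin u + lin v.
Proof. by rewrite /lin /=; lia. Qed.

Lemma index_onto i : (i < 5 * N)%N -> exists c, index c = i.
Proof.
move=> ltiN; have [|| c Ec] := @corner_onto ((i %/ 5)%N%:Z, (i %% 5)%N%:Z).
- by rewrite /=; lia.
- by rewrite /lin /=; lia.
- by exists c; apply/eqP; have [+ _ _] := corner_bounds c;
    rewrite Ec /lin /=; lia.
Qed.

(** Only the fourth shape needs a new anchor: its first cell is [(0, 2)], which is absorbed into the
    translation vector. *)
Lemma is_L_tile_first T :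
  is_L_tile T <-> exists v, exists2 s, s \in first_shapes &
    [seq corner c | c <- enum T] =i translate v s.
Proof.
have shape4 (v : int * int) : translate v [:: (0, 2); (1, 0); (1, 1); (1, 2)] =
    translate (v + (0, 2)) [:: (0, 0); (1, -2); (1, -1); (1, 0)].
  by rewrite /translate /= -!addrA.
split=> -[v [s sL eqT]]; move: sL; rewrite !inE => /or4P[] /eqP Es; subst s.
- by exists v, [:: (0, 0); (0, 1); (0, 2); (1, 0)].
- by exists v, [:: (0, 0); (0, 1); (1, 1); (2, 1)].
- by exists v, [:: (0, 0); (1, 0); (2, 0); (2, 1)].
- exists (v + (0, 2)), [:: (0, 0); (1, -2); (1, -1); (1, 0)] => //.
  by rewrite -shape4.
- by exists v, [:: (0, 0); (0, 1); (0, 2); (1, 0)].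
- by exists v, [:: (0, 0); (0, 1); (1, 1); (2, 1)].
- by exists v, [:: (0, 0); (1, 0); (2, 0); (2, 1)].
- exists (v - (0, 2)), [:: (0, 2); (1, 0); (1, 1); (1, 2)] => //.
  by rewrite shape4 subrK.
Qed.

Lemma mem_tile_at c0 c s (p := index c0) :
  s \in first_shapes -> all (fun u => 0 <= (corner c0).2 + u.2 < 5) s ->
  (c \in tile_at p (offsets s)) = (corner c \in translate (corner c0) s).
Proof.
move=> sL /allP fit_s; rewrite inE.
have [lc yc _] := corner_bounds c; have [lc0 _ _] := corner_bounds c0.
apply/andP/mapP => [[le_pc /mapP[u us Eu]] | [u us Eu]].
  exists u => //; have [_ ge0 _] := first_shapesP sL us.
  apply: lin_inj; rewrite ?fit_s // linD lc lc0; lia.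
have [_ ge0 _] := first_shapesP sL us.
have := linD (corner c0) u; rewrite -Eu lc lc0 => El.
by split; [|apply/mapP; exists u => //]; lia.
Qed.

(** Turns the index set of [card_set_tilings] into an explicit list when [c0] is the first free
    cell. *)
Lemma is_L_tileb_tile_at c0 T (p := index c0) :
  [&& is_L_tileb T, c0 \in T & T \subset region p [::]] =
  (T \in [seq tile_at p t | t <- tile_offsets c0.2
                          & all (fun i => p + i < 5 * N)%N t]).
Proof.
have [lc0 _ _] := corner_bounds c0.
apply/and3P/mapP=> [[/is_L_tileP/is_L_tile_first[v [s sL eqT]] c0T /subsetP sTR]|].
  have inT c : (c \in T) = (corner c \in translate v s).
    by rewrite -eqT (mem_map (@corner_inj _ _)) mem_enum.
  have exT u : u \in s -> exists2 c, c \in T & corner c = v + u.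
    move=> us; have : v + u \in translate v s by rewrite map_f.
    by rewrite -eqT => /mapP[c]; rewrite mem_enum => cT ->; exists c.
  (* Write [corner c0 = v + u]. The cell at [v] is in [T], hence not before [c0], so [lin u <= 0]
     and [u = 0]. *)
  have Ev : v = corner c0.
    move: (c0T); rewrite inT => /mapP[u us Eu].
    have [s0 ge0 eq0] := first_shapesP sL us.
    have [c cT Ec] := exT _ s0; have [lc _ _] := corner_bounds c.
    move: (sTR c cT); rewrite inE andbT => le_pc.
    rewrite Eu eq0 ?addr0 //; move: lc lc0; rewrite Eu Ec !linD {2}/lin /=.
    by rewrite /p in le_pc; lia.
  subst v.
  have fit_s : all (fun u => 0 <= (corner c0).2 + u.2 < 5) s.
    apply/allP=> u us; have [c cT Ec] := exT u us.
    by have [_ + _] := corner_bounds c; rewrite Ec.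
  exists (offsets s); last by apply/setP=> c; rewrite mem_tile_at // inT.
  rewrite mem_filter; apply/andP; split; last first.
    by apply: map_f; rewrite mem_filter sL andbT.
  apply/allP=> _ /mapP[u us ->].
  have [_ ge0 _] := first_shapesP sL us.
  have [c cT Ec] := exT u us; have [lc _ ltc] := corner_bounds c.
  by move: lc; rewrite Ec linD lc0 /p; lia.
case=> t; rewrite mem_filter => /andP[/allP fitN /mapP[s]].
rewrite mem_filter => /andP[fit_s sL] Et ->; rewrite {t}Et in fitN *.
have mem_tile c := mem_tile_at c sL fit_s.
split.
- apply/is_L_tileP/is_L_tile_first; exists (corner c0), s => // z.
  apply/mapP/idP=> [[c]|]; first by rewrite mem_enum mem_tile => ? ->.
  move=> zs; move: (zs) => /mapP[u us Ez].
  have [_ ge0 _] := first_shapesP sL us.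
  have fitu := fitN _ (map_f _ us).
  have [||c Ec] := @corner_onto z.
  - by rewrite Ez; apply: (allP fit_s).
  - by rewrite Ez linD lc0; rewrite /p in fitu; lia.
  by exists c; rewrite ?mem_enum ?mem_tile Ec.
- rewrite mem_tile; apply/mapP; exists 0; rewrite ?addr0 //.
  by move: sL; rewrite !inE => /or4P[] /eqP->.
- by apply/subsetP=> c; rewrite !inE andbT => /andP[].
Qed.

Lemma tile_at_subset p w t : all (fun i => p + i < 5 * N)%N t ->
  (tile_at p t \subset region p w) = ~~ has (mem w) t.
Proof.
move/allP=> fitN; apply/subsetP/hasPn=> [sub i it | nw c].
  have [c Ec] := index_onto (fitN i it).
  by have := sub c; rewrite !inE Ec leq_addr addKn; apply.
by rewrite !inE => /andP[-> /nw].
Qed.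

(** A strictly sorted list is determined by its members, and each offset that fits is realized by a
    cell. *)
Lemma tile_at_inj p t t' : sorted ltn t -> sorted ltn t' ->
  all (fun i => p + i < 5 * N)%N t -> all (fun i => p + i < 5 * N)%N t' ->
  tile_at p t = tile_at p t' -> t = t'.
Proof.
move=> st st' /allP fit /allP fit' eqt.
apply: (irr_sorted_eq ltn_trans ltnn) => // i.
wlog suff sub : t t' st st' fit fit' eqt / i \in t -> i \in t'.
  by apply/idP/idP; apply: sub.
move=> it; have [c Ec] := index_onto (fit i it).
by move/setP/(_ c): eqt; rewrite !inE Ec leq_addr addKn it => /esym.
Qed.

Lemma region_shift p w : 0%N \in w -> region p w = region p.+1 (shift w).
Proof.
move=> w0; apply/setP=> c; rewrite !inE mem_shift.
case: ltngtP => [lt_pc | // | <-]; last by rewrite subnn w0.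
by rewrite subnSK.
Qed.

Lemma regionD p w t : region p w :\: tile_at p t = region p (merge leq w t).
Proof.
apply/setP=> c; rewrite !inE mem_merge mem_cat negb_or.
by case: leqP => //= _; rewrite andbC.
Qed.

(** Induction on the number [q] of cells left, deciding cell [p] at each step. *)
Lemma card_region_tilings p q w : (p + q = 5 * N)%N -> all (fun i => i < q)%N w ->
  #|set_tilings (@is_L_tileb 5 N) (region p w)| = completions q (p %% 5) w.
Proof.
elim: q p w => [|q IHq] p w def_pq fit_w.
  case: w fit_w => // _.
  have -> : region p [::] = set0.
    by apply/setP=> c; rewrite !inE; have [_ _] := corner_bounds c; lia.
  exact: card_set_tilings0.
(* Once the cell [p] is covered, the region can be read from [p.+1], where the induction hypothesis
   applies. *)
have IHt t : 0%N \in merge leq w t -> all (fun i => i <= q)%N t ->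
  #|set_tilings (@is_L_tileb 5 N) (region p (merge leq w t))| =
    completions q ((p %% 5).+1 %% 5) (shift (merge leq w t)).
  move=> w0 fit_t; rewrite region_shift // IHq; last first.
  - apply/allP=> i; rewrite mem_shift mem_merge mem_cat.
    by case/orP=> [/(allP fit_w)|/(allP fit_t)].
  - by rewrite addSnnS.
  by congr completions; lia.
rewrite completionsS big_map; case: ifPn => [w0 | w0N].
  by rewrite big_seq1 -IHt // ?mem_merge ?mem_cat ?w0 //; case: (w).
have [|c0 Ec0] := @index_onto p; first by lia.
have row0 : (p %% 5)%N = c0.2 :> nat.
  by have := ltn_ord c0.2; rewrite -Ec0 /index; lia.
have c0R : c0 \in region p w by rewrite inE Ec0 leqnn subnn.
rewrite (card_set_tilings _ c0R).
set fit := fun t => all (fun i => p + i < 5 * N)%N t.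
(* The tiles through [c0] inside the region, listed without repetition. *)
set r := [seq tile_at p t | t <- tile_offsets (p %% 5) & fit t && ~~ has (mem w) t].
rewrite (eq_bigl (mem r)) => [|T]; last first.
  have := is_L_tileb_tile_at c0 T; rewrite Ec0 -row0 => ET.
  apply/and3P/mapP => [[tT cT TR] | [t]].
    have : T \in [seq tile_at p t | t <- tile_offsets (p %% 5) & fit t].
      rewrite -ET tT cT; apply: subset_trans TR _.
      by apply/subsetP=> c; rewrite !inE => /andP[->].
    case/mapP=> t; rewrite mem_filter => /andP[ft tO] eT; exists t => //.
    by rewrite mem_filter ft tO !andbT -(tile_at_subset w ft) -eT.
  rewrite mem_filter => /andP[/andP[ft nwt] tO] eT.
  have : T \in [seq tile_at p t | t <- tile_offsets (p %% 5) & fit t].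
    by rewrite eT map_f // mem_filter ft.
  by rewrite -ET => /and3P[tT cT _]; split; rewrite // eT tile_at_subset.
rewrite -big_uniq; last first.
  rewrite map_inj_in_uniq ?filter_uniq ?uniq_tile_offsets // => t t'.
  rewrite !mem_filter => /andP[/andP[ft _] tO] /andP[/andP[ft' _] t'O].
  by apply: tile_at_inj ft ft'; apply: sorted_tile_offsets; [exact: tO|exact: t'O].
(* Both sums now run over [tile_offsets]. Fitting tiles agree by [IHt]; those leaving the board
   occur only on the right, where they must contribute zero. *)
rewrite big_map !big_filter [LHS]big_mkcond [RHS]big_mkcond /=.
rewrite [LHS]big_seq [RHS]big_seq; apply: eq_bigr => t tO.
case: ifP => [/andP[ft ->] | nft].
  rewrite regionD IHt //; last by apply/allP=> i /(allP ft); lia.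
  rewrite mem_merge mem_cat; apply/orP; right; move: tO.
  case/mapP=> s; rewrite mem_filter => /andP[_ sL] ->.
  by move: sL; rewrite !inE => /or4P[] /eqP->.
(* Offset 0 fits since [p < 5 * N], so the offending offset is some [i.+1] with [q <= i]. *)
case: ifP nft => // nwt; rewrite andbT => /negbT/allPn[[|i] it nfit].
  by move: nfit; lia.
rewrite (@completions_overflow _ _ _ i) //; last by move: nfit; lia.
by rewrite mem_shift mem_merge mem_cat it orbT.
Qed.

End Board.

Lemma card_tilings5 N : #|tilings 5 N| = completions (5 * N) 0 [::].
Proof. by rewrite -(@card_region_tilings N 0). Qed.

(** * The transfer matrix acting on weighted states *)

Definition weighted := seq (seq nat * nat).

(** The pairing of a row vector of states with the completion counts; its linearity carries
    identities between vectors over to numbers of tilings. *)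
Definition total (q y : nat) (v : weighted) : nat :=
  (\sum_(x <- v) x.2 * completions q y x.1)%N.

Fixpoint add_state (x : seq nat * nat) (v : weighted) : weighted :=
  if v is x' :: v' then
    if x'.1 == x.1 then (x.1, x.2 + x'.2)%N :: v' else x' :: add_state x v'
  else [:: x].

Definition collect (v : weighted) : weighted := foldr add_state [::] v.

(* Collecting equal states keeps the vectors below twenty entries. *)
Definition step (y : nat) (v : weighted) : weighted :=
  collect [seq (w, x.2) | x <- v, w <- succs y x.1].

Fixpoint evolve (n y : nat) (v : weighted) : weighted :=
  if n is n'.+1 then evolve n' (y.+1 %% 5) (step y v) else v.

Definition scale (m : nat) (v : weighted) : weighted :=
  [seq (x.1, m * x.2)%N | x <- v].

Lemma total_cat q y v v' : total q y (v ++ v') = (total q y v + total q y v')%N.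
Proof. exact: big_cat. Qed.

Lemma total_perm q y v v' : perm_eq v v' -> total q y v = total q y v'.
Proof. exact: perm_big. Qed.

Lemma total_scale q y m v : total q y (scale m v) = (m * total q y v)%N.
Proof.
by rewrite /total big_map big_distrr; apply: eq_bigr => x _; rewrite /= mulnA.
Qed.

Lemma total_collect q y v : total q y (collect v) = total q y v.
Proof.
have add x u : total q y (add_state x u) = total q y (x :: u).
  rewrite /total; elim: u => //= x' u IHu; case: eqP => [eqx | _].
    by rewrite !big_cons /= eqx mulnDl addnA.
  by rewrite !big_cons IHu big_cons addnCA.
elim: v => // x v IHv; rewrite /= add [LHS]big_cons [RHS]big_cons.
by congr addn.
Qed.

Lemma total_step q y v : total q.+1 y v = total q (y.+1 %% 5) (step y v).
Proof.
rewrite total_collect /total big_allpairs_dep; apply: eq_bigr => x _.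
by rewrite completionsS big_distrr.
Qed.

Lemma total_evolve n q y v : (y < 5)%N ->
  total (n + q)%N y v = total q ((y + n) %% 5)%N (evolve n y v).
Proof.
elim: n y v => [|n IHn] y v lt_y5; first by rewrite addn0 modn_small.
by rewrite addSn total_step IHn ?ltn_mod //= modnDml addSnnS.
Qed.

(* A block of 8 columns has 40 cells. *)
Definition states (k : nat) : weighted := iter k (evolve 40 0) [:: ([::], 1%N)].

(** Only the first [k] blocks are evaluated, so one relation between state vectors serves every
    [n]. *)
Lemma a_states k n : a (k + n)%N = total (40 * n)%N 0 (states k).
Proof.
rewrite /a card_tilings5; elim: k n => [|k IHk] n.
  by rewrite /total big_seq1 mul1n mulnA.
by rewrite addSnnS IHk mulnS total_evolve.
Qed.

(** Equality of whole vectors, up to the order of entries, so it persists whatever number of columns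
    follows. *)
Lemma states5 :
  perm_eq (states 5) (collect (scale 2 (states 4) ++
                               scale 4 (states 3 ++ states 2 ++ states 1))).
Proof. by vm_compute. Qed.

Lemma a_small : [/\ a 0 = 1, a 1 = 2, a 2 = 7, a 3 = 24 & a 4 = 86]%N.
Proof.
(* With no cell left, only the weight of the empty state counts; the fold replaces the locked big
   sum so that it can be computed. *)
have aE k : a k = foldr (fun x m => x.2 * (x.1 == [::]) + m)%N 0%N (states k).
  by rewrite -[k in LHS]addn0 a_states /total unlock.
by rewrite !aE; split; vm_compute.
Qed.

Lemma a_rec n :
  a (5 + n)%N = (2 * a (4 + n) + 4 * a (3 + n) + 4 * a (2 + n) + 4 * a (1 + n))%N.
Proof.
(* Generalizing states keeps unification from computing it. *)
rewrite !a_states; move: states states5 => st /total_perm ->.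
by rewrite total_collect total_cat !total_scale !total_cat !mulnDr !addnA.
Qed.

(** * Products and quotients of formal power series *)

Section SeriesProduct.
Variable F : fieldType.
Implicit Types f g h : fps F.

(** Coefficient [n] of a product depends only on the factors up to degree [n], so ring laws can be
    imported from polynomials. *)
Lemma fps_mul_trunc f g (p q : {poly F}) n :
  (forall i, (i <= n)%N -> p`_i = f i) -> (forall i, (i <= n)%N -> q`_i = g i) ->
  fps_mul f g n = (p * q)`_n.
Proof.
move=> pf qg; rewrite coefM; apply: eq_bigr => i _.
by rewrite pf ?qg ?leq_subr // -ltnS.
Qed.

Lemma coef_trunc f n i : (i <= n)%N -> (\poly_(j < n.+1) f j)`_i = f i.
Proof. by rewrite coef_poly ltnS => ->. Qed.

Lemma fps_mulA f g h : fps_mul f (fps_mul g h) =1 fps_mul (fps_mul f g) h.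
Proof.
move=> n; pose t k := \poly_(j < n.+1) (k j : F).
have tP k i : (i <= n)%N -> (t k)`_i = k i by apply: coef_trunc.
have tM k k' i : (i <= n)%N -> (t k * t k')`_i = fps_mul k k' i.
  by move=> le_in; apply/esym/fps_mul_trunc => j le_ji; rewrite tP // (leq_trans le_ji).
rewrite (fps_mul_trunc (tP f) (tM g h)) mulrA.
by apply/esym/fps_mul_trunc => i; [exact: tM | exact: tP].
Qed.

Lemma eq_fps_mul f f' g g' : f =1 f' -> g =1 g' -> fps_mul f g =1 fps_mul f' g'.
Proof. by move=> ef eg n; apply: eq_bigr => i _; rewrite ef eg. Qed.

Lemma fps_mulr1 f : fps_mul f (fps_of_poly 1) =1 f.
Proof.
move=> n; rewrite (@fps_mul_trunc _ _ (\poly_(j < n.+1) f j) 1) //.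
  by rewrite mulr1 coef_trunc.
by move=> i; apply: coef_trunc.
Qed.

Lemma eq_fps_div f g h : g 0%N != 0 -> fps_mul f g =1 h -> f =1 fps_div h g.
Proof.
move=> g0 fgh n; rewrite -[LHS]fps_mulr1.
rewrite -(eq_fps_mul (frefl f) (fps_mulV g0)) fps_mulA.
exact: eq_fps_mul.
Qed.

End SeriesProduct.

Theorem proposition3 :
  [/\ (fun n : nat => (a n)%:R : rat) =1
        fps_div
          (fps_of_poly (2 * 'X^4 + 2 * 'X^3 + 'X^2 - 1 : {poly rat}))
          (fps_of_poly (4 * 'X^4 + 4 * 'X^3 + 4 * 'X^2 + 2 * 'X - 1 : {poly rat})),
      (forall n : nat, (5 <= n)%N ->
        a n = (2 * a (n - 1) + 4 * a (n - 2) + 4 * a (n - 3)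
               + 4 * a (n - 4))%N),
      [/\ a 0 = 1%N, a 1 = 2%N, a 2 = 7%N, a 3 = 24%N & a 4 = 86%N] &
      [seq a n | n <- iota 0 8] = [:: 1; 2; 7; 24; 86; 304; 1076; 3808]%N].
Proof.
have [a0 a1 a2 a3 a4] := a_small.
split=> //; last first.
- have a5 := a_rec 0; have a6 := a_rec 1; have a7 := a_rec 2.
  by rewrite /= ?(a0, a1, a2, a3, a4) ?a7 ?a6 ?a5 ?(a1, a2, a3, a4).
- move=> n le5n; rewrite -(subnKC le5n) a_rec.
  by congr (_ * a _ + _ * a _ + _ * a _ + _ * a _)%N; lia.
have -> : 4 * 'X^4 + 4 * 'X^3 + 4 * 'X^2 + 2 * 'X - 1 =
    Poly [:: -1; 2; 4; 4; 4] :> {poly rat}.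
  by rewrite /= !cons_poly_def; ring.
have -> : 2 * 'X^4 + 2 * 'X^3 + 'X^2 - 1 = Poly [:: -1; 0; 1; 2; 2] :> {poly rat}.
  by rewrite /= !cons_poly_def; ring.
(* The constant term [-1] of the denominator is nonzero, so it suffices to multiply out. *)
apply: eq_fps_div => [|n]; rewrite /fps_of_poly coef_Poly //.
rewrite /fps_mul; under eq_bigr do rewrite coef_Poly.
(* Coefficients 0 to 4 come from the initial values, the later ones from the recurrence. *)
do 5?[case: n => [|n]].
- by rewrite !big_ord_recr big_ord0 /= a0.
- by rewrite !big_ord_recr big_ord0 /= a0 a1.
- by rewrite !big_ord_recr big_ord0 /= a0 a1 a2.
- by rewrite !big_ord_recr big_ord0 /= a0 a1 a2 a3.
- by rewrite !big_ord_recr big_ord0 /= a0 a1 a2 a3 a4.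
(* The last six terms are split off; all earlier ones involve a denominator coefficient of degree
   above 5, which vanishes. *)
rewrite !big_ord_recr big1 => [|i _]; last first.
  by rewrite [X in _ * X]nth_default ?mulr0 //=; have := ltn_ord i; lia.
have addK k : (k + n - n = k)%N by apply: addnK.
rewrite /= !subSS subnn (addK 5) (addK 4) (addK 3) (addK 2) (addK 1) /= nth_nil.
by rewrite -[n.+1.+4]/(5 + n)%N a_rec !addSn add0n; ring.
Qed.
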